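(* There are no full orthogonal multiplications of type $[3,4,p]$ when $p=5$ or $p=6$; that is, for $p\in\{5,6\}$ there is no bilinear map $F:\mathbb{R}^3\times\mathbb{R}^4\to\mathbb{R}^p$ with $|F(x,y)|=|x||y|$ for all $x\in\mathbb{R}^3$, $y\in\mathbb{R}^4$ whose image spans $\mathbb{R}^p$.
   Context: An orthogonal multiplication of type $[m,n,p]$ is a bilinear map $F:\mathbb{R}^m\times\mathbb{R}^n\to\mathbb{R}^p$ with $|F(x,y)|=|x||y|$ for all $x,y$ (Euclidean norms). It is full if the image of $F$ spans $\mathbb{R}^p$. *)

(* Defs.v *)
From HB Require Import structures.
From mathcomp Require Import all_boot all_order all_algebra.
From mathcomp Require Import reals.

Set Implicit Arguments.
Unset Strict Implicit.
Unset Printing Implicit Defensive.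

Import Order.TTheory GRing.Theory Num.Theory.
Local Open Scope ring_scope.

(* The library's norm on matrices over a realType is the sup norm, hence a
   separate Euclidean norm on row vectors. *)
Definition enorm (R : realType) (k : nat) (v : 'rV[R]_k) : R :=
  Num.sqrt (\sum_(i < k) v 0 i ^+ 2).

Definition orthogonal_multiplication (R : realType) (m n p : nat)
    (F : {bilinear 'rV[R]_m -> 'rV[R]_n -> 'rV[R]_p}) : Prop :=
  forall (x : 'rV[R]_m) (y : 'rV[R]_n), enorm (F x y) = enorm x * enorm y.

(* The image of F need not be a subspace: every vector is required to be a
   linear combination of finitely many values F x y. *)
Definition full (R : realType) (m n p : nat)
    (F : {bilinear 'rV[R]_m -> 'rV[R]_n -> 'rV[R]_p}) : Prop :=
  forall v : 'rV[R]_p, exists s : seq ('rV[R]_m * 'rV[R]_n),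
    v \in <<[seq F z.1 z.2 | z <- s]>>%VS.

(* Main.v *)
Require Import Defs.
From HB Require Import structures.
From mathcomp Require Import all_boot all_order all_algebra.
From mathcomp Require Import reals.
From mathcomp Require Import ring lra.

Set Implicit Arguments.
Unset Strict Implicit.
Unset Printing Implicit Defensive.

Import Order.TTheory GRing.Theory Num.Theory.
Local Open Scope ring_scope.

(** The slices A = F x1, B = F x2, C = F x3 of an orthogonal multiplication F
    at orthonormal vectors x1, x2, x3 are isometries, and polarizing
    |F x y| = |x| |y| shows that each product of two of them, such as
    (u, v) |-> <A u, B v>, is an alternating form.  The claim is that for
    source dimension 4 and p <= 6, these slices have the same image; then F takes
    its values in one space of dimension 4, which is a proper subspace of R^p
    for p = 5 and p = 6.

    Since 4 + 4 > 6, the images of A and B meet ([common_value]): there are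
    orthonormal y, y' with A y = B y', and then A y' = - B y.  Complete them to
    an orthonormal basis y, y', z, z' of R^4, and put g = <A z, B z'>.  The
    vectors k1 = B z' - g A z and k2 = B z + g A z' are the components of B z'
    and B z orthogonal to the image of A; they are orthogonal to each other and
    both have squared length 1 - g^2.

    If g^2 = 1, they vanish and the image of B is contained in that of A.
    Otherwise A y, A y', A z, A z', k1, k2 are, up to scaling, six orthonormal
    vectors in a space of dimension at most 6, hence a basis.  By the
    alternating relations, the coordinates of C y, C z, C z' in it are given by
    g, the 2x2 matrix of the numbers <A u, C v> for u in {y, y'}, v in {z, z'},
    and the numbers <A z, C z'> and <B z, C z'>.  That C is an isometry then becomes a
    system of real quadratic equations without solution
    ([third_isometry_absurd]): the matrix is a multiple of a rotation or of a
    reflection, this forces the two remaining numbers to vanish, so the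
    matrix is orthogonal, and then the length of C y forces g^2 = 1.  This is
    the only place where a third dimension of the source is used; it cannot be
    avoided, as R^2 and R^4 do have a full multiplication into R^6. *)

(** * Euclidean inner product and orthonormal families *)

Definition dot (R : realType) (n : nat) (u v : 'rV[R]_n) : R :=
  \sum_(i < n) u 0 i * v 0 i.

Lemma dotE (R : realType) n (u v : 'rV[R]_n) : dot u v = (u *m v^T) 0 0.
Proof. by rewrite mxE; apply: eq_bigr => i _; rewrite mxE. Qed.

Lemma dotC (R : realType) n (u v : 'rV[R]_n) : dot u v = dot v u.
Proof. by apply: eq_bigr => i _; rewrite mulrC. Qed.

Lemma dotDl (R : realType) n (u u' v : 'rV[R]_n) :
  dot (u + u') v = dot u v + dot u' v.
Proof. by rewrite !dotE mulmxDl mxE. Qed.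

Lemma dotZl (R : realType) n a (u v : 'rV[R]_n) : dot (a *: u) v = a * dot u v.
Proof. by rewrite !dotE -scalemxAl mxE. Qed.

Lemma dotDr (R : realType) n (u v v' : 'rV[R]_n) :
  dot u (v + v') = dot u v + dot u v'.
Proof. by rewrite dotC dotDl !(dotC u). Qed.

Lemma dotZr (R : realType) n a (u v : 'rV[R]_n) : dot u (a *: v) = a * dot u v.
Proof. by rewrite dotC dotZl (dotC u). Qed.

Lemma dotNl (R : realType) n (u v : 'rV[R]_n) : dot (- u) v = - dot u v.
Proof. by rewrite -scaleN1r dotZl mulN1r. Qed.

Lemma dotNr (R : realType) n (u v : 'rV[R]_n) : dot u (- v) = - dot u v.
Proof. by rewrite dotC dotNl dotC. Qed.

Definition dot_linE := (dotDl, dotDr, dotZl, dotZr, dotNl, dotNr).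

Lemma dot_ge0 (R : realType) n (u : 'rV[R]_n) : 0 <= dot u u.
Proof. by apply: sumr_ge0 => i _; rewrite -expr2 sqr_ge0. Qed.

Lemma dot_eq0 (R : realType) n (u : 'rV[R]_n) : (dot u u == 0) = (u == 0).
Proof.
apply/eqP/eqP => [/eqP u0|->]; last by rewrite dotE mul0mx mxE.
apply/rowP => i; rewrite mxE; apply/eqP; move: u0.
rewrite psumr_eq0 => [/allP /(_ i)|j _]; last by rewrite -expr2 sqr_ge0.
by rewrite mem_index_enum mulf_eq0 orbb; apply.
Qed.

Lemma normalizable (R : realType) n (u : 'rV[R]_n) :
  u != 0 -> exists a : R, dot (a *: u) (a *: u) = 1.
Proof.
rewrite -dot_eq0 => u0; exists (Num.sqrt (dot u u))^-1; rewrite !dot_linE.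
by rewrite mulrA -invfM -expr2 sqr_sqrtr ?dot_ge0 // mulVf.
Qed.

Lemma wide_kernel (R : realType) n k (M : 'M[R]_(n, k)) :
  (k < n)%N -> exists2 v : 'rV_n, v *m M = 0 & v != 0.
Proof.
move=> kn; have /rowV0Pn[v /sub_kermxP vM v0] : kermx M != 0.
  by rewrite kermx_eq0 -row_leq_rank -ltnNge (leq_ltn_trans (rank_leq_col M)).
by exists v.
Qed.

Definition orthonormal (R : realType) n (s : seq 'rV[R]_n) : bool :=
  all (fun u => dot u u == 1) s && pairwise (fun u v => dot u v == 0) s.

Lemma orthonormal_nth (R : realType) n (s : seq 'rV[R]_n) i j :
  orthonormal s -> (i < size s)%N -> (j < size s)%N ->
  dot s`_i s`_j = (i == j)%:R.
Proof.
move=> /andP[/(all_nthP 0) s1 /(pairwiseP 0) s0] si sj.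
case: (ltngtP i j) => [ij|ji|->]; last exact/eqP/s1.
- exact/eqP/s0.
- by rewrite dotC; apply/eqP/s0.
Qed.

(** Orthogonality to the vectors of [s] is a homogeneous system with fewer
    equations than unknowns. *)
Lemma orthonormal_extend (R : realType) n (s : seq 'rV[R]_n) :
  orthonormal s -> (size s < n)%N -> exists v, orthonormal (rcons s v).
Proof.
move=> /andP[s1 s0] sn.
have [v vM v0] := wide_kernel (\matrix_(i < n, j < size s) s`_j 0 i) sn.
have [a a1] := normalizable v0; exists (a *: v).
rewrite /orthonormal all_rcons a1 eqxx s1 pairwise_rcons s0 /= andbT.
apply/(all_nthP 0) => i si; apply/eqP; rewrite dotC dotZl.
suff -> : dot v s`_i = 0 by rewrite mulr0.
move/rowP: vM => /(_ (Ordinal si)); rewrite !mxE => <-.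
by apply: eq_bigr => j _; rewrite mxE.
Qed.

(** Orthonormal rows are independent, so there are at most [n] of them; the
    matrix is therefore square, and a one-sided inverse is two-sided. *)
Lemma orthogonal_mxC (R : realType) k n (E : 'M[R]_(k, n)) :
  (n <= k)%N -> E *m E^T = 1%:M -> E^T *m E = 1%:M.
Proof.
move=> nk EE; have /eqP kn : k == n.
  rewrite eqn_leq nk andbT -(mxrank1 R k) -EE.
  exact: leq_trans (mxrankM_maxl _ _) (rank_leq_col _).
by move: E EE; rewrite kn => E; exact: mulmx1C.
Qed.

(** The hypothesis on the size is an inequality so that no equation between
    the dimension and the number of vectors is needed beforehand: an ambient
    space of too small a dimension is excluded by the same argument. *)
Lemma orthonormal_expansion (R : realType) n (s : seq 'rV[R]_n) u :
  orthonormal s -> (n <= size s)%N -> u = \sum_(e <- s) dot u e *: e.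
Proof.
move=> os; rewrite (big_nth 0) big_mkord => ns.
pose E : 'M[R]_(size s, n) := \matrix_(i < size s) s`_i.
have EE : E *m E^T = 1%:M.
  apply/matrixP => i j.
  rewrite !mxE -(orthonormal_nth os (ltn_ord i) (ltn_ord j)).
  by apply: eq_bigr => k _; rewrite !mxE.
have EC : E^T *m E = 1%:M by apply: orthogonal_mxC.
rewrite -{1}[u]mulmx1 -EC mulmxA mulmx_sum_row.
apply: eq_bigr => i _; congr (_ *: _).
  by rewrite mxE; apply: eq_bigr => j _; rewrite !mxE.
by apply/rowP => j; rewrite !mxE.
Qed.

Lemma parseval (R : realType) n (s : seq 'rV[R]_n) u v :
  orthonormal s -> (n <= size s)%N ->
  dot u v = \sum_(e <- s) dot u e * dot v e.
Proof.
move=> os ns; rewrite {1}(orthonormal_expansion u os ns).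
elim/big_rec2: _ => [|e x y _ <-]; first by rewrite dotE mul0mx mxE.
by rewrite dotDl dotZl (dotC e).
Qed.

(** * Slices of an orthogonal multiplication *)

Lemma dotF (R : realType) m n p
    (F : {bilinear 'rV[R]_m -> 'rV[R]_n -> 'rV[R]_p}) x y :
  orthogonal_multiplication F ->
  dot (F x y) (F x y) = dot x x * dot y y.
Proof.
have enormE k (u : 'rV[R]_k) : enorm u ^+ 2 = dot u u.
  rewrite sqr_sqrtr; first by apply: eq_bigr => i _.
  by apply: sumr_ge0 => i _; rewrite sqr_ge0.
by move=> /(_ x y) Fxy; rewrite -!enormE Fxy exprMn.
Qed.

Lemma dotF_same (R : realType) m n p
    (F : {bilinear 'rV[R]_m -> 'rV[R]_n -> 'rV[R]_p}) x y y' :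
  orthogonal_multiplication F ->
  dot (F x y) (F x y') = dot x x * dot y y'.
Proof.
move=> oF; have := dotF x (y + y') oF.
rewrite linearDr !dot_linE !dotF // (dotC y' y) (dotC (F x y') _); lra.
Qed.

(** Polarization in the first argument: the slice at [x + x'] also scales inner
    products by a constant, so the cross terms cancel. *)
Lemma dotF_skew (R : realType) m n p
    (F : {bilinear 'rV[R]_m -> 'rV[R]_n -> 'rV[R]_p}) x x' y y' :
  orthogonal_multiplication F -> dot x x' = 0 ->
  dot (F x y) (F x' y') = - dot (F x y') (F x' y).
Proof.
move=> oF xx'; have := dotF_same (x + x') y y' oF.
rewrite !linearDl !dot_linE !dotF_same // (dotC x' x) xx' (dotC (F x' y)); lra.
Qed.

(** The images have dimension [n] in a space of dimension less than [2 n], so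
    they meet.  If [F x1 y = F x2 y'], the alternating relation gives
    [<y', y> = <F x2 y', F x2 y> = <F x1 y, F x2 y> = 0] and
    [<F x1 y', F x2 y> = - <F x1 y, F x2 y'> = - 1]; as these are unit vectors,
    they are opposite. *)
Lemma common_value (R : realType) m n p
    (F : {bilinear 'rV[R]_m -> 'rV[R]_n -> 'rV[R]_p}) x1 x2 :
  orthogonal_multiplication F -> orthonormal [:: x1; x2] -> (p < n + n)%N ->
  exists y y', [/\ orthonormal [:: y; y'], F x1 y = F x2 y'
                 & F x1 y' = - F x2 y].
Proof.
move=> oF; rewrite /orthonormal /= !andbT => /andP[/andP[/eqP x11 /eqP x22]].
move=> /eqP x12 pn.
have [w] := wide_kernel (col_mx (lin1_mx (F x1)) (lin1_mx (F x2))) pn.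
rewrite -[w]hsubmxK mul_row_col !mul_rV_lin1 /=.
set y := lsubmx w; set z := rsubmx w => yz w0.
have Fyz : F x1 y = F x2 (- z).
  by rewrite linearNr; apply/eqP; rewrite -addr_eq0 yz.
have nyz : dot y y = dot z z.
  by have := dotF x1 y oF; rewrite Fyz dotF // !dot_linE x11 x22; lra.
have y0 : y != 0.
  apply: contraNneq w0 => y0; rewrite y0.
  suff /eqP -> : z == 0 by rewrite row_mx0.
  by rewrite -dot_eq0 -nyz y0 dotE mul0mx mxE.
have [a a1] := normalizable y0.
pose u := a *: y; pose u' := a *: - z.
have u1 : dot u u = 1 by [].
have u'1 : dot u' u' = 1 by rewrite -u1 !dot_linE nyz opprK.
have Fuu : F x1 u = F x2 u' by rewrite !linearZr /= Fyz.
have uu' : dot u u' = 0.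
  have := dotF_skew u u oF x12; rewrite [in X in X = _]Fuu.
  rewrite Fuu dotF_same // x22 (dotC u'); lra.
exists u, u'; split => //; first by rewrite /orthonormal /= u1 u'1 uu' !eqxx.
apply/eqP; rewrite -addr_eq0 -dot_eq0 !dot_linE !dotF_same //.
rewrite (dotC (F x2 u)) (dotF_skew _ _ oF x12) Fuu dotF_same //.
by rewrite x11 x22 u1 u'1; apply/eqP; lra.
Qed.

(** * The case of three isometries *)

(** The equations say that [C] is an isometry, with
    [a1 = <A y, C z>], [a2 = <A y, C z'>], [a3 = <A y', C z>],
    [a4 = <A y', C z'>], [b = <A z, C z'>], [c = <B z, C z'>] and
    [q = 1 / (1 - g ^+ 2)], the factor which normalizes the last two vectors of
    the basis.  They are, in order, the inner products of [C z] with itself, of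
    [C z'] with itself, of [C z] with [C z'], of [C y] with itself, with [C z]
    and with [C z'].  The first three make the columns of the matrix
    [[a1, a2], [a3, a4]] orthogonal of equal length. *)
Lemma third_isometry_absurd (R : realFieldType) (g q a1 a2 a3 a4 b c : R) :
  q * (1 - g ^+ 2) = 1 -> 0 < 1 - g ^+ 2 ->
  a1 ^+ 2 + a3 ^+ 2 + b ^+ 2 + q * (c ^+ 2 + (g * b) ^+ 2) = 1 ->
  a2 ^+ 2 + a4 ^+ 2 + b ^+ 2 + q * (c ^+ 2 + (g * b) ^+ 2) = 1 ->
  a1 * a2 + a3 * a4 = 0 ->
  a1 ^+ 2 + a2 ^+ 2 + q * ((a4 + g * a1) ^+ 2 + (a3 - g * a2) ^+ 2) = 1 ->
  b * a2 - q * (c * (a4 + g * a1) + g * b * (a3 - g * a2)) = 0 ->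
  b * a1 + q * (g * b * (a4 + g * a1) - c * (a3 - g * a2)) = 0 ->
  False.
Proof.
move=> qg g1 e1 e2 e3 e4 h5 h6.
have e4' : a1 ^+ 2 + a2 ^+ 2 + a3 ^+ 2 + a4 ^+ 2
    + 2 * g * (a1 * a4 - a2 * a3) = 1 - g ^+ 2.
  apply: subr0_eq.
  transitivity ((1 - g ^+ 2) *
      (a1 ^+ 2 + a2 ^+ 2 + q * ((a4 + g * a1) ^+ 2 + (a3 - g * a2) ^+ 2) - 1)
    - (q * (1 - g ^+ 2) - 1) * ((a4 + g * a1) ^+ 2 + (a3 - g * a2) ^+ 2)).
    by ring.
  by rewrite e4 qg; ring.
have e5 : b * (a2 - g * a3) = c * (a4 + g * a1).
  apply: subr0_eq.
  transitivity ((1 - g ^+ 2) *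
      (b * a2 - q * (c * (a4 + g * a1) + g * b * (a3 - g * a2)))
    + (q * (1 - g ^+ 2) - 1) * (c * (a4 + g * a1) + g * b * (a3 - g * a2))).
    by ring.
  by rewrite h5 qg; ring.
have e6 : b * (a1 + g * a4) = c * (a3 - g * a2).
  apply: subr0_eq.
  transitivity ((1 - g ^+ 2) *
      (b * a1 + q * (g * b * (a4 + g * a1) - c * (a3 - g * a2)))
    - (q * (1 - g ^+ 2) - 1) * (g * b * (a4 + g * a1) - c * (a3 - g * a2))).
    by ring.
  by rewrite h6 qg; ring.
have bc0 : b = 0 -> c = 0 -> a1 ^+ 2 + a3 ^+ 2 = 1 /\ a2 ^+ 2 + a4 ^+ 2 = 1.
  by move=> b0 c0; move: e1 e2; rewrite b0 c0 !expr2; split; lra.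
(* The matrix is conformal: a multiple of a rotation (first factor zero) or
   of a reflection (second factor zero). *)
have dich : ((a1 - a4) ^+ 2 + (a2 + a3) ^+ 2) *
            ((a1 + a4) ^+ 2 + (a2 - a3) ^+ 2) = 0.
  have e : a1 ^+ 2 + a3 ^+ 2 = a2 ^+ 2 + a4 ^+ 2 by lra.
  have -> : ((a1 - a4) ^+ 2 + (a2 + a3) ^+ 2) *
            ((a1 + a4) ^+ 2 + (a2 - a3) ^+ 2) =
    ((a1 ^+ 2 + a3 ^+ 2) - (a2 ^+ 2 + a4 ^+ 2)) ^+ 2
    + 4 * (a1 * a2 + a3 * a4) ^+ 2 by ring.
  by rewrite e e3; ring.
(* Both cases at once: s = 1 for rotations, s = - 1 for reflections. *)
have sgn s : s ^+ 2 = 1 -> a4 = s * a1 -> a3 = - s * a2 -> False.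
  move=> s1 h4 h3.
  have sg : 1 + s * g != 0.
    apply: contraTneq g1 => sg.
    have -> : 1 - g ^+ 2 = (1 + s * g) * (1 - s * g) + (s ^+ 2 - 1) * g ^+ 2.
      by ring.
    by rewrite sg s1 subrr !mul0r addr0 ltxx.
  (* That C y is orthogonal to C z and to C z' is a linear system for b and
     s * c with determinant a1 ^+ 2 + a2 ^+ 2. *)
  have f5 : (1 + s * g) * (b * a2 - s * c * a1) = 0.
    transitivity (b * (a2 - g * a3) - c * (a4 + g * a1)
                  - (s ^+ 2 - 1) * c * g * a1); first by rewrite h3 h4; ring.
    by rewrite e5 s1; ring.
  have f6 : (1 + s * g) * (b * a1 + s * c * a2) = 0.
    transitivity (b * (a1 + g * a4) - c * (a3 - g * a2)
                  + (s ^+ 2 - 1) * c * g * a2); first by rewrite h3 h4; ring.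
    by rewrite e6 s1; ring.
  move/eqP: f5; rewrite mulf_eq0 (negPf sg) => /eqP f5.
  move/eqP: f6; rewrite mulf_eq0 (negPf sg) => /eqP f6.
  (* The length of C y: it bounds the matrix away from zero, hence b = c = 0;
     but a matrix with unit columns makes the left-hand side 2 (1 + s g). *)
  have N : (1 + s * g) * (2 * (a1 ^+ 2 + a2 ^+ 2)) = 1 - g ^+ 2.
    by rewrite -e4' h3 h4 !exprMn sqrrN s1; ring.
  have aa0 : a1 ^+ 2 + a2 ^+ 2 != 0.
    by apply: contraTneq g1 => aa; rewrite -N aa !mulr0 ltxx.
  have hb : b = 0.
    apply: (mulIf aa0); rewrite mul0r.
    transitivity (a2 * (b * a2 - s * c * a1) + a1 * (b * a1 + s * c * a2)).
      by ring.
    by rewrite f5 f6 !mulr0 addr0.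
  have hc : c = 0.
    apply: (mulIf aa0); rewrite mul0r -[c]mul1r -s1.
    transitivity
      (s * (a2 * (b * a1 + s * c * a2) - a1 * (b * a2 - s * c * a1))).
      by ring.
    by rewrite f5 f6 !mulr0 subrr mulr0.
  have [f1 _] := bc0 hb hc.
  have h3' : a3 ^+ 2 = a2 ^+ 2 by rewrite h3 exprMn sqrrN s1 mul1r.
  have aa1 : a1 ^+ 2 + a2 ^+ 2 = 1 by rewrite -h3'.
  have : (1 + s * g) ^+ 2 = 0.
    have -> : (1 + s * g) ^+ 2 = 1 + 2 * s * g + s ^+ 2 * g ^+ 2 by ring.
    by rewrite s1; move: N; rewrite aa1; lra.
  by move/eqP; rewrite sqrf_eq0 (negPf sg).
have sq0 (x y : R) : x ^+ 2 + y ^+ 2 == 0 -> x = 0 /\ y = 0.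
  by rewrite paddr_eq0 ?sqr_ge0 // !sqrf_eq0 => /andP[/eqP-> /eqP->].
move/eqP: dich; rewrite mulf_eq0 => /orP[] /sq0 [h1 h2].
  by apply: (sgn 1); [rewrite expr1n | lra | lra].
by apply: (sgn (-1)); [rewrite sqrrN expr1n | lra | lra].
Qed.

Lemma slice_image_sub (R : realType) m p
    (F : {bilinear 'rV[R]_m -> 'rV[R]_4 -> 'rV[R]_p}) x1 x2 x3 v :
  orthogonal_multiplication F -> (p <= 6)%N ->
  orthonormal [:: x1; x2; x3] -> exists v', F x2 v = F x1 v'.
Proof.
move=> oF p6; rewrite /orthonormal /= !andbT.
case/and3P=> /and3P[/eqP x11 /eqP x22 /eqP x33].
move=> /andP[/eqP x12 /eqP x13] /eqP x23.
have o12 : orthonormal [:: x1; x2] by rewrite /orthonormal /= x11 x22 x12 !eqxx.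
have p8 : (p < 4 + 4)%N by apply: leq_ltn_trans p6 _.
have [y [y' [oy FyE Fy'E]]] := common_value oF o12 p8.
have [z oz] := orthonormal_extend oy isT.
have [z' os] := orthonormal_extend oz isT.
move: (os); rewrite /orthonormal /= !andbT.
case/andP=> /and4P[/eqP yy /eqP y'y' /eqP zz /eqP z'z'].
case/and3P=> /and3P[/eqP yy' /eqP yz /eqP yz'].
move=> /andP[/eqP y'z /eqP y'z'] /eqP zz'.
have x31 : dot x3 x1 = 0 by rewrite dotC.
have x32 : dot x3 x2 = 0 by rewrite dotC.
have AA u w := dotF_same x1 u w oF.
have BB u w := dotF_same x2 u w oF.
have AB u w := dotF_skew u w oF x12.
have CA u w := dotF_skew u w oF x31.
have CB u w := dotF_skew u w oF x32.
have CC u w := dotF_same x3 u w oF.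
have CAd u : dot (F x3 u) (F x1 u) = 0 by have := CA u u; lra.
have CBd u : dot (F x3 u) (F x2 u) = 0 by have := CB u u; lra.
have ABd u : dot (F x1 u) (F x2 u) = 0 by have := AB u u; lra.
pose g := dot (F x1 z) (F x2 z').
have Az'Bz : dot (F x1 z') (F x2 z) = - g by rewrite AB.
have AyB u : dot (F x1 y) (F x2 u) = dot y' u by rewrite FyE BB x22 mul1r.
have Ay'B u : dot (F x1 y') (F x2 u) = - dot y u.
  by rewrite Fy'E dotNl BB x22 mul1r.
pose k1 := F x2 z' - g *: F x1 z.
pose k2 := F x2 z + g *: F x1 z'.
have k11 : dot k1 k1 = 1 - g ^+ 2.
  by rewrite !dot_linE BB AA (dotC (F x2 z')) -/g x11 x22 zz z'z'; ring.
have k22 : dot k2 k2 = 1 - g ^+ 2.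
  by rewrite !dot_linE BB AA (dotC (F x2 z)) Az'Bz x11 x22 zz z'z'; ring.
have k12 : dot k1 k2 = 0.
  by rewrite !dot_linE BB AA (dotC (F x2 z')) !ABd (dotC z') zz'; ring.
(* If k1 = k2 = 0, then B maps the basis into the image of A. *)
have [g1|g1] := eqVneq (1 - g ^+ 2) 0.
  have Bz' : F x2 z' = g *: F x1 z.
    by apply/eqP; rewrite -subr_eq0 -dot_eq0 k11 g1.
  have Bz : F x2 z = - (g *: F x1 z').
    by apply/eqP; rewrite -subr_eq0 opprK -dot_eq0 k22 g1.
  exists (dot v y *: - y' + (dot v y' *: y
    + (dot v z *: - (g *: z') + dot v z' *: (g *: z)))).
  rewrite {1}(orthonormal_expansion v os isT) !big_cons big_nil addr0.
  by rewrite !(linearDr, linearNr, linearZr) /= Bz Bz' -FyE Fy'E opprK.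
have q0 : 0 < 1 - g ^+ 2 by rewrite lt0r g1 -k11 dot_ge0.
pose r := (Num.sqrt (1 - g ^+ 2))^-1.
have rg : r ^+ 2 * (1 - g ^+ 2) = 1.
  by rewrite exprVn sqr_sqrtr ?ltW // mulVf.
have oE : orthonormal [:: F x1 y; F x1 y'; F x1 z; F x1 z'; r *: k1; r *: k2].
  have rr : r * (r * (1 - g ^+ 2)) = 1 by rewrite mulrA -expr2.
  rewrite /orthonormal /= !(dotZl, dotZr) k11 k22 k12 rr !dot_linE.
  rewrite !AA !AyB !Ay'B !ABd Az'Bz -/g x11 (dotC z').
  rewrite yy y'y' zz z'z' yy' yz yz' y'z y'z' zz'.
  by rewrite !(mulr0, mulr1, oppr0, addr0, subrr, addNr, eqxx).
have pv u w := parseval u w oE p6.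
pose a1 := dot (F x3 z) (F x1 y); pose a2 := dot (F x3 z') (F x1 y).
pose a3 := dot (F x3 z) (F x1 y'); pose a4 := dot (F x3 z') (F x1 y').
pose b := dot (F x3 z') (F x1 z); pose c := dot (F x3 z') (F x2 z).
have CzAz' : dot (F x3 z) (F x1 z') = - b by rewrite CA.
have CzBz' : dot (F x3 z) (F x2 z') = - c by rewrite CB.
have CyAy' : dot (F x3 y) (F x1 y') = 0 by rewrite Fy'E dotNr CBd oppr0.
have CyAz : dot (F x3 y) (F x1 z) = - a1 by rewrite CA.
have CyAz' : dot (F x3 y) (F x1 z') = - a2 by rewrite CA.
have CyBz : dot (F x3 y) (F x2 z) = a3 by rewrite CB /a3 Fy'E dotNr.
have CyBz' : dot (F x3 y) (F x2 z') = a4 by rewrite CB /a4 Fy'E dotNr.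
have Cyk1 : dot (F x3 y) k1 = a4 + g * a1 by rewrite !dot_linE CyBz' CyAz; ring.
have Cyk2 : dot (F x3 y) k2 = a3 - g * a2 by rewrite !dot_linE CyBz CyAz'; ring.
have Czk1 : dot (F x3 z) k1 = - c by rewrite !dot_linE CzBz' CAd; ring.
have Czk2 : dot (F x3 z) k2 = - (g * b) by rewrite !dot_linE CBd CzAz'; ring.
have Cz'k1 : dot (F x3 z') k1 = - (g * b) by rewrite !dot_linE CBd -/b; ring.
have Cz'k2 : dot (F x3 z') k2 = c by rewrite !dot_linE CAd -/c; ring.
(* Parseval for C u and C w; the scalings by r give the factor r ^+ 2. *)
have pvE u w : dot u w =
  dot (F x3 u) (F x1 y) * dot (F x3 w) (F x1 y) +
  dot (F x3 u) (F x1 y') * dot (F x3 w) (F x1 y') +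
  dot (F x3 u) (F x1 z) * dot (F x3 w) (F x1 z) +
  dot (F x3 u) (F x1 z') * dot (F x3 w) (F x1 z') +
  r ^+ 2 * (dot (F x3 u) k1 * dot (F x3 w) k1 +
    dot (F x3 u) k2 * dot (F x3 w) k2).
  rewrite -[LHS]mul1r -x33 -CC pv !big_cons big_nil !(dotZr r); ring.
exfalso; apply: (@third_isometry_absurd _ g (r ^+ 2) a1 a2 a3 a4 b c rg q0).
- rewrite -zz pvE CAd CzAz' Czk1 Czk2 -/a1 -/a3; ring.
- rewrite -z'z' pvE CAd Cz'k1 Cz'k2 -/a2 -/a4 -/b; ring.
- rewrite -zz' pvE !CAd CzAz' Czk1 Czk2 Cz'k1 Cz'k2.
  by rewrite -/a1 -/a2 -/a3 -/a4 -/b; ring.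
- rewrite -yy pvE CAd CyAy' CyAz CyAz' Cyk1 Cyk2; ring.
- rewrite -yz pvE !CAd CyAy' CyAz CyAz' Cyk1 Cyk2 CzAz' Czk1 Czk2; ring.
- rewrite -[RHS]oppr0 -yz' pvE !CAd CyAy' CyAz CyAz' Cyk1 Cyk2 Cz'k1 Cz'k2 -/b.
  by ring.
Qed.

Theorem corollary4 (R : realType) (p : nat) (hp : p = 5%N \/ p = 6%N) :
  ~ exists F : {bilinear 'rV[R]_3 -> 'rV[R]_4 -> 'rV[R]_p},
      orthogonal_multiplication F /\ full F.
Proof.
case=> F [oF fullF].
have p6 : (p <= 6)%N by case: hp => ->.
have p4 : (4 < p)%N by case: hp => ->.
have dim_rV k : \dim {:'rV[R]_k} = k by rewrite dimvf dim_matrix mul1r.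
have o0 : orthonormal ([::] : seq 'rV[R]_3) by [].
have [x1 o1] := orthonormal_extend o0 isT.
have [x2 o2] := orthonormal_extend o1 isT.
have [x3 o3] := orthonormal_extend o2 isT.
have o3' : orthonormal [:: x1; x3; x2].
  move: o3; rewrite /orthonormal /= !andbT (dotC x3 x2).
  by case/andP=> /and3P[-> -> ->] /andP[/andP[-> ->] ->].
have Fx1 x y : F x y \in limg (linfun (F x1)).
  rewrite {1}(orthonormal_expansion x o3 isT) !big_cons big_nil addr0.
  have [v2 F2] := slice_image_sub y oF p6 o3.
  have [v3 F3] := slice_image_sub y oF p6 o3'.
  rewrite !linearDl !linearZl /= F2 F3 -!linearZr -!linearDr /= -lfunE.
  exact: memv_img (memvf _).
have /dimvS : (fullv <= limg (linfun (F x1)))%VS.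
  apply/subvP => v _; have [s] := fullF v.
  by apply/subvP/span_subvP => _ /mapP[u _ ->].
rewrite dim_rV leqNgt => /negP; apply.
apply: leq_ltn_trans p4; have := limg_ker_dim (linfun (F x1)) fullv.
by rewrite dim_rV => dim4; rewrite -[leqRHS]dim4 leq_addl.
Qed.
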